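(* For every $r\ge1$ and the symmetric whisker graph $G$ consisting of a distinguished edge with $r$ leaves attached at each of its two endvertices, there exists $\alpha_G>1$ such that for all $\alpha>\alpha_G$ the WARM on $G$ with $W(x)=x^\alpha$ has at least one linearly-stable equilibrium (i.e. $(\mathcal S_\alpha)_G\neq\varnothing$). Consequently, for any finite connected graph $G$ and any symmetric whisker-forest $\mathbf G$ on $G$, there is a constant (depending on $\mathbf G$) such that $\mathbf G$ admits a $(G,\alpha)$-stable allocation for every $\alpha$ larger than this constant.
   Context: A symmetric whisker-forest on $G=(V,E)$ is a collection $\mathbf G=\{G_j\}_{j=1}^k$ of connected subgraphs $G_j=(V_j,E_j)$ of $G$ with $|V_j|\ge2$, $V=\bigcup_jV_j$, $V_j\cap V_{j'}=\varnothing$ for $j\ne j'$, in which each $G_j$ is either a star graph (a central vertex joined by one or more edges to leaves) or a symmetric whisker graph (a distinguished edge with $r\ge1$ leaves attached at each of its two endvertices, where $r$ may depend on $j$). $\mathbf E=\bigcup_jE_j$. $\mathbf G$ admits a $(G,\alpha)$-stable allocation if there is an equilibrium $\vec v$ of the WARM on $G$ with $W(x)=x^\alpha$, with $v_e>0$ for all $e\in\mathbf E$ and $v_e=0$ for all $e\in E\setminus\mathbf E$, that is linearly stable or critical. WARM on $G$: the colours are the edges; at each time a vertex is chosen uniformly at random and one edge incident to it is selected with probability proportional to (its current count)$^\alpha$ and its count is increased by one. With $\Delta_{E}=\{\vec v\in\mathbb R^{E}:v_e\ge0,\ \sum_{e}v_e=1\}$, define for $\vec v\in\Delta_E$ $$F(\vec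 v)_e=-v_e+\frac1{|V|}\sum_{x\in e}\frac{v_e^\alpha}{\sum_{e'\in E:\,x\in e'}v_{e'}^\alpha},\qquad e\in E,$$ where $x\in e$ means that $x$ is an endvertex of $e$ (and $0/0$ is read as $0$; then $F(\vec v)=\vec 0$ forces every denominator to be positive). An equilibrium is a $\vec v\in\Delta_E$ with $F(\vec v)=\vec 0$. At an equilibrium, $\mathbf D(\vec v)$ is the matrix of partial derivatives $D_{e,e'}=\partial F(\vec v)_e/\partial v_{e'}$ (one-sided at points with zero coordinates). The equilibrium is linearly stable if all eigenvalues of $\mathbf D(\vec v)$ have negative real parts, linearly unstable if some eigenvalue has positive real part, and critical otherwise. *)

(* Defs.v *)
From mathcomp Require Import all_boot all_order all_algebra.
From mathcomp Require Import complex.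
From mathcomp Require Import all_classical all_reals all_analysis.
Import Order.TTheory GRing.Theory Num.Theory.
Import numFieldNormedType.Exports.

Set Implicit Arguments.
Unset Strict Implicit.
Unset Printing Implicit Defensive.

Local Open Scope ring_scope.

(* A graph is given by a vertex set [U] and an edge set [F], an edge being    *)
(* the two-element set of its endvertices.  [U] is a subset of an ambient     *)
(* finite type, so that subgraphs of a graph (setT, E) have the same form.    *)
Section Graphs.
Variable V : finType.
Implicit Types (U L A B : {set V}) (E F : {set {set V}}).

Definition graph U F : Prop :=
  forall e, e \in F -> #|e| = 2%N /\ e \subset U.

(* For a graph (U, F), an F-path starting in U stays in U.                    *)
Definition connected_graph U F : Prop :=
  [/\ graph U F, (0 < #|U|)%N &
    forall x y, x \in U -> y \in U ->
      connect [rel a b | [set a; b]%SET \in F] x y].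

Definition star_graph U F : Prop :=
  exists (c : V) (L : {set V}),
    [/\ (0 < #|L|)%N, c \notin L, U = (c |: L)%SET
      & F = [set [set c; x]%SET | x in L]%SET].

Definition sym_whisker_graph (r : nat) U F : Prop :=
  exists (a b : V) (A B : {set V}),
    [/\ a != b,
        [disjoint A & B] /\ [disjoint [set a; b]%SET & A :|: B],
        #|A| = r /\ #|B| = r,
        U = ([set a; b] :|: (A :|: B))%SET
      & F = ([set a; b]%SET |: ([set [set a; x]%SET | x in A]
                               :|: [set [set b; x]%SET | x in B]))%SET].

Definition sym_whisker_forest E k
    (VV : 'I_k -> {set V}) (EE : 'I_k -> {set {set V}}) : Prop :=
  [/\ forall j, connected_graph (VV j) (EE j) /\ EE j \subset E,
      forall j, (2 <= #|VV j|)%N,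
      (\bigcup_j VV j)%SET = [set: V]%SET,
      forall i j, i != j -> [disjoint VV i & VV j]
    & forall j, star_graph (VV j) (EE j) \/
        exists2 r, (1 <= r)%N & sym_whisker_graph r (VV j) (EE j)].

End Graphs.

Local Open Scope classical_set_scope.

(* The WARM on the graph (setT, E) with W(x) = x^alpha.                       *)
Section WARM.
Variables (R : realType) (V : finType) (E : {set {set V}}) (alpha : R).

Definition edge : finType := {e : {set V} | e \in E}.

Implicit Types (v : edge -> R) (A : {set {set V}}).

(* Division by zero gives 0, and [0 `^ alpha = 0] when [alpha != 0].          *)
Definition warm_F v (e : edge) : R :=
  - v e + (#|V|%:R)^-1 *
    \sum_(x in val e)
      v e `^ alpha / \sum_(e' : edge | x \in val e') v e' `^ alpha.

Definition equilibrium v : Prop :=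
  [/\ forall e, 0 <= v e, \sum_(e : edge) v e = 1
    & forall e, warm_F v e = 0].

(* The increment [h] keeps the coordinate [v e'] nonnegative, so this is the  *)
(* ordinary partial derivative if [0 < v e'] and the right one if [v e' = 0]. *)
Definition warm_partial v (e e' : edge) : R :=
  lim ((fun h : R =>
          (warm_F (fun e0 => v e0 + h * (e0 == e')%:R) e - warm_F v e) / h)
       @ within [set h | 0 <= v e' + h] 0^').

Definition warm_D v : 'M[R]_#|{: edge}| :=
  \matrix_(i, j) warm_partial v (enum_val i) (enum_val j).

Definition warm_eigenvalue v (z : R[i]) : Prop :=
  eigenvalue (map_mx (real_complex R) (warm_D v)) z.

Definition linearly_stable v : Prop :=
  forall z, warm_eigenvalue v z -> complex.Re z < 0.

Definition linearly_unstable v : Prop :=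
  exists2 z, warm_eigenvalue v z & 0 < complex.Re z.

Definition critical v : Prop := ~ linearly_stable v /\ ~ linearly_unstable v.

Definition support_is A v : Prop :=
  forall e : edge, (val e \in A -> 0 < v e) /\ (val e \notin A -> v e = 0).

(* (S_alpha)_A: the linearly stable equilibria whose support is A.            *)
Definition stable_equilibria A : set (edge -> R) :=
  [set v | [/\ equilibrium v, support_is A v & linearly_stable v]].

Definition admits_stable_allocation k (EE : 'I_k -> {set {set V}}) : Prop :=
  exists v : edge -> R,
    [/\ equilibrium v, support_is (\bigcup_j EE j)%SET v
      & linearly_stable v \/ critical v].

End WARM.

Arguments stable_equilibria {R V} E alpha A.
Arguments admits_stable_allocation {R V} E alpha {k} EE.

(* Main.v *)
(* For large alpha there is an equilibrium close to the point where, in every *)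
(* tree of the forest, one edge ab (the distinguished edge of a whisker       *)
(* graph, any edge of a star) has weight 2/n and all others 1/n, n = |V|: at  *)
(* a and b the edge ab then takes nearly the whole share, as (1/2)^alpha is   *)
(* tiny.  Let a and b carry together t leaves, s at each endpoint that has    *)
(* leaves at all (both, or only one for a star).  If q is the share of a leaf *)
(* edge at its hub, then the leaf edges weigh (1 + q)/n and ab weighs         *)
(* (2 - t q)/n, so the equilibrium equations of the tree reduce to            *)
(*   q = z^alpha / (1 + s z^alpha)   with   z = (1 + q) / (2 - t q),          *)
(* which the intermediate value theorem solves with 0 < q <= (3/4)^alpha.     *)
(* At this point every entry of D + 1 is O(alpha (3/4)^alpha), because at     *)
(* each vertex one edge takes all but an O((3/4)^alpha) share; hence the      *)
(* spectrum of D lies in a small disc around -1.                              *)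

Require Import Defs.
From mathcomp Require Import all_boot all_order all_algebra.
From mathcomp Require Import complex.
From mathcomp Require Import all_classical all_reals all_analysis.
From mathcomp Require Import ring lra zify.
Import Order.TTheory GRing.Theory Num.Theory.
Import numFieldNormedType.Exports.
Local Open Scope classical_set_scope.
Local Open Scope ring_scope.

Set Implicit Arguments.
Unset Strict Implicit.
Unset Printing Implicit Defensive.

(** For large alpha the choice at a vertex is nearly winner-takes-all. Suppose that at every vertex
    one edge leaves at most a share eta to the others, and that every positive weight is at least
    1/n. Then each derivative of a share contains a product of two relative weights, one of which is
    at most eta, so the entries of D + 1 are at most 2 alpha eta in absolute value
    ([warm_partial_bound]); with m edges the spectrum of D lies within m times this bound of -1
    ([linearly_stable_of_entries]). Edges of weight 0 do no harm, since x^alpha has derivative 0 at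
    0; hence the graph around the forest may be arbitrary.

    For existence, stars and symmetric whisker graphs are both double stars in which each hub has
    either no leaves or a number s common to the tree. All leaf edges of a tree then have the same
    share q at their hub, and the equilibrium system becomes one scalar equation ([share_equation],
    [forest_equilibrium]). Its solution allows eta = n (3/4)^alpha, and alpha (3/4)^alpha tends to 0
    ([linear_powR_lt1]). Distinct trees share no vertex, so their encodings glue
    ([forest_partner_map]), and [partner_map_stable] yields both claims, a whisker graph being a
    forest with one tree. *)

Section Derivative.
Variable R : realType.

(** * Difference quotients along one-sided filters *)

Lemma dnbhs0_neq0 : \forall h \near (0 : R)^', h != 0.
Proof. by rewrite /dnbhs near_withinE; exact: nearW. Qed.

Lemma within_dnbhs_ge_proper (a : R) : 0 <= a ->
  ProperFilter (within [set h | 0 <= a + h] 0^').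
Proof.
move=> a0; apply: Build_ProperFilter_ex => P.
rewrite /within /= => /nbhs_ballP[e /= e0 eP].
exists (e / 2); apply: eP => /=.
- rewrite /ball /= sub0r normrN gtr0_norm; lra.
- by rewrite lt0r_neq0//; lra.
- lra.
Qed.

(** At a = 0 only h > 0 remains and the quotient is h^(p-1), which tends to 0 because p > 1. For a >
    0 the filter refines the punctured neighbourhood of 0, so the ordinary derivative serves. *)
Lemma powR_diff_quotient (a p : R) : 0 <= a -> 1 < p ->
  ((a + h) `^ p - a `^ p) / h @[h --> within [set h | 0 <= a + h] 0^']
    --> p * a `^ (p - 1).
Proof.
rewrite le_eqVlt => /predU1P[<-|a0] p1.
  have -> : p * 0 `^ (p - 1) = 0 :> R by rewrite powR0 ?mulr0//; lra.
  have /powR_cvg0 cp : 0 < p - 1 by lra.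
  have : a `^ (p - 1) @[a --> within [set h : R | 0 <= 0 + h] 0^'] --> (0 : R).
    apply: cvg_trans cp; apply: cvg_app => P.
    rewrite /at_right /within /= => /nbhs_ballP[e e0 eP].
    apply/nbhs_ballP; exists e => // h /= eh h0; rewrite add0r => h0'.
    by apply: eP => //; rewrite lt_neqAle eq_sym h0.
  apply: cvg_trans; apply: near_eq_cvg.
  near=> h.
  have h0 : h != 0 by near: h; apply: cvg_within; exact: dnbhs0_neq0.
  have h0' : 0 <= h by rewrite -[h]add0r; near: h; exact: withinT.
  have hp : 0 < h by rewrite lt_neqAle eq_sym h0.
  rewrite powR0 ?subr0; last by rewrite gt_eqF //; lra.
  rewrite /= add0r -[in RHS](mulr_powRB1 (ltW hp)); last lra.
  by rewrite mulrC mulKf.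
have D : is_derive a 1 (@powR R ^~ p) (p * a `^ (p - 1)).
  exact: is_derive1_powR.
apply: cvg_within_filter.
have <- := @derive_val _ _ _ _ _ _ _ D.
have := @ex_derive _ _ _ _ _ _ _ D.
rewrite /derivable /derive => c.
apply: cvg_trans c; apply: near_eq_cvg; near=> h.
by rewrite /= scaler1 mulrC [h + a]addrC.
Unshelve. all: by end_near. Qed.

(** Quotient rule for a share whose numerator and denominator are both affine in one increment
    [g h]; here [a] and [b] will be the 0-1 indicators that the varied edge enters them. *)
Lemma ratio_diff_quotient (F : set_system R) (FF : Filter F)
    (g : R -> R) (d n s a b : R) :
  F --> 0^' -> g h / h @[h --> F] --> d -> s != 0 ->
  ((n + a * g h) / (s + b * g h) - n / s) / h @[h --> F]
    --> d * (a * s - n * b) / s ^+ 2.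
Proof.
move=> F0 gd s0.
have Fn0 : F [set h | h != 0].
  by apply: F0; exact: dnbhs0_neq0.
have id0 : h @[h --> F] --> (0 : R).
  apply: cvg_trans F0 _; exact: cvg_within.
have g0 : g h @[h --> F] --> (0 : R).
  rewrite -(mulr0 d); apply: cvg_trans (cvgM gd id0).
  apply: near_eq_cvg; near=> h; rewrite /= divfK//; near: h; exact: Fn0.
have sg : s + b * g h @[h --> F] --> s.
  rewrite -[X in _ --> X]addr0 -(mulr0 b).
  by apply: cvgD; [exact: cvg_cst|apply: cvgM => //; exact: cvg_cst].
have : g h / h * (a * s - n * b) / (s * (s + b * g h)) @[h --> F]
    --> d * (a * s - n * b) / s ^+ 2.
  apply: cvgM; first by apply: cvgM => //; exact: cvg_cst.
  rewrite expr2; apply: cvgV; first by rewrite mulf_neq0.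
  by apply: cvgM => //; exact: cvg_cst.
apply: cvg_trans; apply: near_eq_cvg.
have sgn : \forall h \near F, s + b * g h != 0.
  exact: (cvgr_neq0 _ sg).
near=> h.
have h0 : h != 0 by near: h; exact: Fn0.
have sh : s + b * g h != 0 by near: h.
by field; rewrite h0 s0 sh.
Unshelve. all: by end_near. Qed.

End Derivative.

(** * The matrix D and a criterion for linear stability *)

Section Stability.
Variables (R : realType) (V : finType) (E : {set {set V}}) (alpha : R).
Implicit Types (v : edge E -> R) (e d : edge E) (x : V).

Definition vertex_weight v x : R :=
  \sum_(e : edge E | x \in val e) v e `^ alpha.

Lemma powR_perturb v e e' h :
  (v e + h * (e == e')%:R) `^ alpha = v e `^ alpha +
    (e == e')%:R * ((v e' + h) `^ alpha - v e' `^ alpha).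
Proof.
by case: eqVneq => [->|_]; rewrite ?mulr1 ?mul1r ?subrKC// mulr0 mul0r !addr0.
Qed.

Lemma vertex_weight_perturb v e' h x :
  vertex_weight (fun e => v e + h * (e == e')%:R) x =
  vertex_weight v x
    + (x \in val e')%:R * ((v e' + h) `^ alpha - v e' `^ alpha).
Proof.
rewrite /vertex_weight (eq_bigr _ (fun e _ => powR_perturb v e e' h)).
rewrite big_split/=.
congr (_ + _).
rewrite -mulr_suml; congr (_ * _); rewrite -natr_sum; congr (_%:R).
have [xe'|xe'] := boolP (x \in val e').
  by rewrite (bigD1 e')//= eqxx big1 // => e /andP[_ /negPf ->].
by rewrite big1// => e xe; case: eqVneq => // ee'; rewrite -ee' xe in xe'.
Qed.

Lemma warm_FE v e : warm_F alpha v e = - v e + (#|V|%:R)^-1 *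
  \sum_(x in val e) v e `^ alpha / vertex_weight v x.
Proof. by []. Qed.

Lemma warm_partialE v e e' : 1 < alpha -> (forall e, 0 <= v e) ->
  (forall x, vertex_weight v x != 0) ->
  warm_partial alpha v e e' = - (e == e')%:R + (#|V|%:R)^-1 *
    \sum_(x in val e) alpha * v e' `^ (alpha - 1) *
      ((e == e')%:R * vertex_weight v x - v e `^ alpha * (x \in val e')%:R)
      / vertex_weight v x ^+ 2.
Proof.
move=> a1 v0 S0; rewrite /warm_partial.
set F := within _ _.
have PF : ProperFilter F by exact: within_dnbhs_ge_proper.
have gd : ((v e' + h) `^ alpha - v e' `^ alpha) / h @[h --> F]
    --> alpha * v e' `^ (alpha - 1) by exact: powR_diff_quotient.
have F0 : F --> (0 : R)^' by exact: cvg_within.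
apply: cvg_lim => //.
have : - (e == e')%:R + (#|V|%:R)^-1 * \sum_(x in val e)
     ((v e `^ alpha + (e == e')%:R * ((v e' + h) `^ alpha - v e' `^ alpha))
     / (vertex_weight v x
        + (x \in val e')%:R * ((v e' + h) `^ alpha - v e' `^ alpha))
     - v e `^ alpha / vertex_weight v x) / h @[h --> F] -->
   - (e == e')%:R + (#|V|%:R)^-1 *
    \sum_(x in val e) alpha * v e' `^ (alpha - 1) *
      ((e == e')%:R * vertex_weight v x - v e `^ alpha * (x \in val e')%:R)
      / vertex_weight v x ^+ 2.
  apply: cvgD; first exact: cvg_cst.
  apply: cvgM; first exact: cvg_cst.
  apply: cvg_big => [|x _]; first exact: add_continuous.
  exact: ratio_diff_quotient.
apply: cvg_trans; apply: near_eq_cvg; near=> h.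
have h0 : h != 0 by near: h; apply: F0; exact: dnbhs0_neq0.
rewrite !warm_FE -mulr_suml sumrB.
under [X in _ = (_ + _ * X - _) / _]eq_bigr => x _
  do rewrite vertex_weight_perturb powR_perturb.
(* The sums are abstracted to scalars so that [field] sees a small identity. *)
have alg (d n s t w : R) : - d + n * ((s - t) / h) =
    (- (w + h * d) + n * s - (- w + n * t)) / h by field.
exact: alg.
Unshelve. all: by end_near. Qed.

(** For a left eigenvector u, (z + 1) u = u (D + 1); comparing l1 norms gives |z + 1| <= m eta < 1
    with m the number of edges, so Re z < 0. *)
Lemma linearly_stable_of_entries v (eta : R) :
  (forall e e', `|warm_partial alpha v e e' + (e == e')%:R| <= eta) ->
  #|{: edge E}|%:R * eta < 1 -> linearly_stable alpha v.
Proof.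
move=> Deta eta1 z /eigenvalueP[u uD u0].
have uE j : (z + 1) * u ord0 j =
    \sum_i u ord0 i * (warm_D alpha v i j + (i == j)%:R)%:C%C.
  have /rowP/(_ j) := uD; rewrite !mxE => uDj.
  rewrite mulrDl mul1r -uDj.
  under [RHS]eq_bigr => i _ do rewrite rmorphD rmorph_nat mulrDr /=.
  rewrite big_split /=; congr (_ + _).
    by apply: eq_bigr => i _; rewrite [in LHS]mxE.
  rewrite (bigD1 j)//= eqxx mulr1 big1 ?addr0// => i /negPf ->.
  by rewrite mulr0.
(* Summing |z + 1| |u_j| over j, rather than maximizing over j, is enough. *)
pose T := \sum_i `|u ord0 i|.
have T0 : 0 < T.
  have /rV0Pn[i0 ui0] := u0.
  rewrite /T (bigD1 i0)//= ltr_pwDl ?normr_gt0// sumr_ge0//.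
have : `|z + 1| * T <= (#|{: edge E}|%:R * eta)%:C%C * T.
  rewrite /T mulr_sumr.
  apply: (@le_trans _ _ (\sum_(j < #|{: edge E}|)
    \sum_i `|u ord0 i| * eta%:C%C)).
    apply: ler_sum => j _; rewrite -normrM uE.
    apply: le_trans (ler_norm_sum _ _ _) _; apply: ler_sum => i _.
    rewrite normrM ler_wpM2l// normc_def /= expr0n addr0 sqrtr_sqr lecR mxE.
    have := Deta (enum_val i) (enum_val j).
    by rewrite (inj_eq enum_val_inj).
  rewrite sumr_const -mulr_suml card_ord -/T rmorphM rmorph_nat /=.
  by rewrite -[leLHS]mulr_natl [_ * eta%:C%C]mulrC mulrA.
rewrite ler_pM2r// => z1.
have := le_trans (normc_ge_Re (z + 1)) z1.
rewrite lecR => /le_lt_trans/(_ eta1).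
rewrite (raddfD (@complex.Re R)) /= => /ltr_normlP[]; lra.
Qed.

Lemma vertex_weight_ge v e x : x \in val e -> v e `^ alpha <= vertex_weight v x.
Proof.
by move=> xe; rewrite /vertex_weight (bigD1 e)//= lerDl sumr_ge0// => *;
  exact: powR_ge0.
Qed.

Lemma vertex_weight_ge2 v d e x : x \in val d -> x \in val e -> e != d ->
  v e `^ alpha <= vertex_weight v x - v d `^ alpha.
Proof.
move=> xd xe ed; rewrite lerBrDl /vertex_weight (bigD1 d)//= (bigD1 e)/= ?xe//.
by rewrite lerD2l lerDl sumr_ge0// => *; exact: powR_ge0.
Qed.

(** Each endvertex of e contributes at most alpha eta n to the sum; there are two of them, and the
    prefactor 1/n cancels n. *)
Lemma warm_partial_bound v (eta : R) e e' : 1 < alpha -> (forall e, 0 <= v e) ->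
  (forall e, 0 < v e -> (#|V|%:R)^-1 <= v e) ->
  (forall x, 0 < vertex_weight v x) -> 0 <= eta ->
  (forall x, exists2 d : edge E, x \in val d &
     vertex_weight v x - v d `^ alpha <= eta * vertex_weight v x) ->
  #|val e| = 2%N ->
  `|warm_partial alpha v e e' + (e == e')%:R| <= 2 * alpha * eta.
Proof.
move=> a1 v0 vn S0 eta0 vd e2.
have n0 : (0 : R) < #|V|%:R.
  by rewrite ltr0n (leq_trans _ (max_card (mem (val e))))// e2.
rewrite warm_partialE//; last by move=> x; rewrite gt_eqF.
rewrite addrC addrA subrr add0r normrM gtr0_norm ?invr_gt0//.
rewrite mulrC ler_pdivrMr//; apply: le_trans (ler_norm_sum _ _ _) _.
apply: (@le_trans _ _ (\sum_(x in val e) (alpha * eta * #|V|%:R))); last first.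
  by rewrite sumr_const e2 -mulr_natl; lra.
apply: ler_sum => x xe; set S := vertex_weight v x.
have Sx : 0 < S by exact: S0.
(* For e = e' the factors are S - v_e^alpha and v_e^alpha; for e != e' they are v_e^alpha and
   v_e'^alpha. In each case one of them omits the dominant edge [d], hence is at most eta S, and the
   other is at most S. *)
have ratio_le : `|(e == e')%:R * S - v e `^ alpha * (x \in val e')%:R|
    * v e' `^ alpha <= eta * S ^+ 2.
  have [d xd dS] := vd x; rewrite -/S in dS.
  have eS := @vertex_weight_ge v e x xe; rewrite -/S in eS.
  have [xe'|xe'] := boolP (x \in val e'); last first.
    have -> : (e == e') = false by apply: contraNF xe' => /eqP <-.
    by rewrite mul0r mulr0 subrr normr0 mul0r mulr_ge0// exprn_ge0// ltW.
  have e'S := @vertex_weight_ge v e' x xe'; rewrite -/S in e'S.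
  have ge0 := powR_ge0 (v e) alpha; have ge0' := powR_ge0 (v e') alpha.
  rewrite mulr1 expr2 mulrA; case: eqVneq => [ee'|ee'].
    rewrite mul1r ger0_norm ?subr_ge0// -ee'.
    have [ed|ed] := eqVneq e d.
      by apply: ler_pM => //; [rewrite subr_ge0|rewrite ed].
    rewrite mulrC; apply: ler_pM => //; rewrite ?subr_ge0//; last lra.
    by apply: le_trans dS; exact: vertex_weight_ge2.
  rewrite mul0r sub0r normrN ger0_norm//.
  have [ed|ed] := eqVneq e d.
    rewrite mulrC; apply: ler_pM => //; apply: le_trans dS.
    by apply: vertex_weight_ge2 => //; rewrite -ed eq_sym.
  by apply: ler_pM => //; apply: le_trans dS; exact: vertex_weight_ge2.
(* A zero coordinate gives a zero column of D + 1, because alpha - 1 > 0. *)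
have [ve'|ve'] := eqVneq (v e') 0.
  rewrite ve' powR0 ?mulr0 ?mul0r ?normr0 ?mulr_ge0//; last by lra.
  by apply: ltW; lra.
have v'0 : 0 < v e' by rewrite lt_neqAle eq_sym ve' v0.
have a0 : 0 < alpha by lra.
rewrite normrM (gtr0_norm (x := (S ^+ 2)^-1)) ?invr_gt0 ?exprn_gt0//.
rewrite ler_pdivrMr ?exprn_gt0// normrM [`|_ * v e' `^ _|]ger0_norm; last first.
  by rewrite mulr_ge0 ?powR_ge0// ltW.
have -> : v e' `^ (alpha - 1) = v e' `^ alpha / v e'.
  by rewrite -(mulr_powRB1 (v0 e') a0) mulrC mulKf.
have vn' : (v e')^-1 <= #|V|%:R.
  by rewrite -[leRHS]invrK lef_pV2 ?posrE ?invr_gt0// vn.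
rewrite [leLHS](_ : _ = alpha *
    (`|(e == e')%:R * S - v e `^ alpha * (x \in val e')%:R| * v e' `^ alpha
     * (v e')^-1)); last by ring.
rewrite [leRHS](_ : _ = alpha * (eta * S ^+ 2 * #|V|%:R)); last by ring.
rewrite ler_pM2l//; apply: ler_pM => //; first by rewrite mulr_ge0 ?powR_ge0.
by rewrite invr_ge0.
Qed.

Lemma dominated_linearly_stable v (eta : R) :
  1 < alpha -> (forall e, 0 <= v e) ->
  (forall e, 0 < v e -> (#|V|%:R)^-1 <= v e) ->
  (forall x, 0 < vertex_weight v x) -> 0 <= eta ->
  (forall x, exists2 d : edge E, x \in val d &
     vertex_weight v x - v d `^ alpha <= eta * vertex_weight v x) ->
  (forall e, #|val e| = 2%N) ->
  #|{: edge E}|%:R * (2 * alpha * eta) < 1 -> linearly_stable alpha v.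
Proof.
move=> a1 v0 vn S0 eta0 vd e2; apply: linearly_stable_of_entries => e e'.
exact: warm_partial_bound.
Qed.

(** Summed by vertices instead of edges, the shares at each vertex add up to 1; normalization is
    thus automatic for zeros of F. *)
Lemma warm_sum_eq1 v : (0 < #|V|)%N -> (forall x, vertex_weight v x != 0) ->
  (forall e, warm_F alpha v e = 0) -> \sum_e v e = 1.
Proof.
move=> n0 S0 F0.
have vE e : v e = (#|V|%:R)^-1 *
    \sum_(x in val e) v e `^ alpha / vertex_weight v x.
  by have /eqP := F0 e; rewrite warm_FE addrC subr_eq0 => /eqP.
rewrite (eq_bigr _ (fun e _ => vE e)) -mulr_sumr.
rewrite (exchange_big_dep predT)//=.
rewrite (eq_bigr (fun=> 1)); last first.
  by move=> x _; rewrite -mulr_suml; rewrite mulfV; [by []|exact: (S0 x)].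
by rewrite sumr_const cardT -cardE mulVf// pnatr_eq0 -lt0n.
Qed.

End Stability.

(** * The scalar equation for the leaf share, and the size of alpha *)

Section Solve.
Variable R : realType.

(** With c = - ln r, r^(-a) = (exp (c a / 2))^2 >= (c a / 2)^2, which exceeds K a once a > 4 K /
    c^2. *)
Lemma linear_powR_lt1 (K r : R) : 0 < K -> 0 < r < 1 ->
  exists2 C : R, 1 < C & forall a, C < a -> K * a * r `^ a < 1.
Proof.
move=> K0 /andP[r0 r1].
have c0 : 0 < - ln r by rewrite oppr_gt0 ln_lt0// r0.
set c := - ln r in c0.
exists (1 + 4 * K / c ^+ 2).
  by rewrite ltrDl divr_gt0 ?exprn_gt0// mulr_gt0.
move=> a aC.
have c20 : 0 < c ^+ 2 by rewrite exprn_gt0.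
have a0 : 0 < a.
  by apply: lt_trans aC; rewrite ltr_wpDr// divr_ge0 ?ltW// mulr_gt0.
have Kac : 4 * K < c ^+ 2 * a.
  by rewrite [ltRHS]mulrC -ltr_pdivrMr//; apply: le_lt_trans aC; lra.
rewrite /powR gt_eqF//.
have -> : a * ln r = - (c * a / 2 + c * a / 2) by rewrite /c; field.
rewrite expRN ltr_pdivrMr ?expR_gt0// mul1r expRD.
have ca : 0 < c * a / 2 by rewrite divr_gt0// mulr_gt0.
have := @expR_ge1Dx R (c * a / 2).
set y := expR _; set w := c * a / 2 in ca *; move=> wy.
have wK : K * a < w ^+ 2.
  have -> : w ^+ 2 = (c ^+ 2 * a) / 4 * a by rewrite /w; field.
  by rewrite ltr_pM2r// ltr_pdivlMr// mulrC.
by apply: lt_le_trans wK _; rewrite expr2; apply: ler_pM; lra.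
Qed.

Lemma continuous_powR_gt0 (a x : R) : 0 < x ->
  {for x, continuous (@powR R ^~ a)}.
Proof.
move=> x0; apply: differentiable_continuous; apply/derivable1_diffP.
exact: (@ex_derive _ _ _ _ _ _ _ (is_derive1_powR a x0)).
Qed.

(** Intermediate value theorem for q minus the right-hand side on [0, q0]: it is nonpositive at 0,
    and nonnegative at q0 since the right-hand side is at most (3/4)^alpha. *)
Lemma share_equation (alpha q0 : R) (s t : nat) :
  0 < alpha -> 0 < q0 <= 4^-1 -> t%:R * q0 <= 4^-1 ->
  (3 / 4) `^ alpha <= q0 ->
  exists q : R, [/\ 0 < q <= (3 / 4) `^ alpha, t%:R * q <= 4^-1 &
    q = ((1 + q) / (2 - t%:R * q)) `^ alpha
        / (1 + s%:R * ((1 + q) / (2 - t%:R * q)) `^ alpha)].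
Proof.
move=> a0 /andP[q00 q04] tq0 rq0.
pose z (q : R) := (1 + q) / (2 - t%:R * q).
have tq (q : R) : 0 <= q <= q0 -> 0 <= t%:R * q <= 4^-1.
  move=> /andP[q0' qq0]; rewrite mulr_ge0//=; apply: le_trans tq0.
  by rewrite ler_wpM2l.
have z0 (q : R) : 0 <= q <= q0 -> 0 < z q.
  move=> qI; have /andP[? ?] := tq _ qI; move: qI => /andP[? ?].
  by rewrite /z divr_gt0//; lra.
(* From q <= 1/4 and t q <= 1/4, z is at most (5/4) / (7/4) = 5/7. *)
have z34 (q : R) : 0 <= q <= q0 -> z q <= 3 / 4.
  move=> qI; have /andP[? ?] := tq _ qI; move: qI => /andP[? ?].
  by rewrite /z ler_pdivrMr; lra.
have za (q : R) : 0 <= q <= q0 -> z q `^ alpha <= (3 / 4) `^ alpha.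
  move=> qI; apply: ge0_ler_powR; rewrite ?nnegrE//; first exact: ltW.
  - exact/ltW/z0.
  - exact: z34.
have den (q : R) : 1 <= 1 + s%:R * z q `^ alpha.
  by rewrite lerDl mulr_ge0// powR_ge0.
have share_le (q : R) :
    z q `^ alpha / (1 + s%:R * z q `^ alpha) <= z q `^ alpha.
  by rewrite ler_pdivrMr ?ler_peMr ?powR_ge0//; apply: lt_le_trans (den q).
pose g (q : R) := q - z q `^ alpha / (1 + s%:R * z q `^ alpha).
have gc : {within `[0, q0], continuous g}.
  apply: continuous_in_subspaceT => q; rewrite inE/= in_itv/= => qI.
  have cz : {for q, continuous z}.
    have := tq _ qI => /andP[_ ?].
    apply: cvgM; first by apply: cvgD; [exact: cvg_cst|exact: cvg_id].
    apply: cvgV; first by rewrite gt_eqF//; lra.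
    apply: cvgB; first exact: cvg_cst.
    by apply: cvgM; [exact: cvg_cst|exact: cvg_id].
  have cza : {for q, continuous (fun q => z q `^ alpha)}.
    apply: (@continuous_comp _ _ _ z (@powR R ^~ alpha)) => //.
    exact/continuous_powR_gt0/z0.
  apply: cvgB; first exact: cvg_id.
  apply: cvgM => //; apply: cvgV.
    by rewrite gt_eqF// (lt_le_trans _ (den q)).
  apply: cvgD; first exact: cvg_cst.
  by apply: cvgM => //; exact: cvg_cst.
have I0 : 0 <= (0 : R) <= q0 by rewrite lexx ltW.
have Iq : 0 <= q0 <= q0 by rewrite lexx ltW.
have g0 : g 0 <= 0.
  rewrite /g sub0r oppr_le0 divr_ge0 ?powR_ge0//.
  exact: le_trans (den 0).
have gq0 : 0 <= g q0.
  by rewrite subr_ge0 (le_trans (share_le _))// (le_trans (za _ Iq)).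
have [|q] := @IVT R g 0 q0 0 (ltW q00) gc.
  by rewrite ge_min le_max g0 gq0 orbT.
rewrite in_itv/= => qI /eqP; rewrite subr_eq0 => /eqP qE.
have /andP[_ tq4] := tq _ qI.
exists q; split => //.
rewrite {2}qE (le_trans (share_le q) (za q qI)) andbT.
rewrite qE divr_gt0 ?powR_gt0 ?z0//.
exact: lt_le_trans (den q).
Qed.

End Solve.

(* A forest of double stars is encoded by a map [f] on its vertices: it swaps *)
(* the endpoints of the central edge of each tree and sends every leaf to its *)
(* neighbour, so that the edges are the pairs {x, f x} and the endpoints of   *)
(* central edges are the [x] with [f (f x) = x].                              *)
Section DoubleStarForest.
Variables (R : realType) (V : finType) (E : {set {set V}}) (f : V -> V).
Hypothesis f_neq : forall x, f x != x.
Hypothesis fff : forall x, f (f (f x)) = f x.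
Hypothesis fE : forall x, [set x; f x]%SET \in E.

Definition partner_edge x : edge E := exist _ [set x; f x]%SET (fE x).

(** The condition [y != f x] discards the other hub, which [f] also sends to [x]. *)
Definition leaves x : {set V} := [set y | (f y == x) && (y != f x)]%SET.

Lemma partner_edge_inj x y :
  partner_edge x = partner_edge y -> y = x \/ y = f x /\ f y = x.
Proof.
move=> /(congr1 val) /= exy.
have := set21 y (f y); have := set22 y (f y); rewrite -exy.
move=> /set2P[fyx|fyx] /set2P[yx|yx]; [by left| by right| by left|].
by have := f_neq y; rewrite fyx yx eqxx.
Qed.

Lemma partner_edge_hub x : f (f x) = x -> partner_edge (f x) = partner_edge x.
Proof. by move=> ffx; apply: val_inj; rewrite /= ffx finset.setUC. Qed.

Lemma leaf_not_hub x y : y \in leaves x -> f (f y) != y.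
Proof. by rewrite inE => /andP[/eqP-> ]; rewrite eq_sym. Qed.

Lemma leaves_not_hub x : f (f x) != x -> leaves x = finset.set0.
Proof.
move=> ffx; apply/setP => y; rewrite !inE; apply/negP => /andP[/eqP fy _].
by move: ffx; rewrite -fy fff eqxx.
Qed.

Section Weights.
Variable w : V -> R.
Hypothesis w_hub : forall x, f (f x) = x -> w (f x) = w x.

(** A central edge is named by both of its ends; [w_hub] makes the value independent of the one
    picked. *)
Definition forest_weight (e : edge E) : R :=
  if [pick x | e == partner_edge x] is Some x then w x else 0.

Lemma forest_weight_partner x : forest_weight (partner_edge x) = w x.
Proof.
rewrite /forest_weight; case: pickP => [y /eqP|].
  case/partner_edge_inj => [->//|[yE fyE]].
  by rewrite yE w_hub// -yE.
by move=> /(_ x); rewrite eqxx.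
Qed.

Lemma forest_weight0 e : (forall x, e <> partner_edge x) -> forest_weight e = 0.
Proof. by rewrite /forest_weight => H; case: pickP => // x /eqP /H. Qed.

Lemma vertex_weight_forest alpha x : alpha != 0 ->
  vertex_weight alpha forest_weight x =
  w x `^ alpha + \sum_(y in leaves x) w y `^ alpha.
Proof.
move=> a0; rewrite /vertex_weight (bigD1 (partner_edge x))/= ?set21//.
rewrite forest_weight_partner; congr (_ + _).
rewrite (bigID (mem [set partner_edge y | y in leaves x]%SET))/=.
rewrite [X in _ + X]big1 ?addr0; last first.
  move=> e /andP[/andP[xe ex] enl]; rewrite forest_weight0 ?powR0// => y ey.
  move: xe ex enl; rewrite ey !inE/= => /orP[/eqP->|/eqP xE ex /imsetP].
    by rewrite eqxx.
  apply; exists y => //; rewrite inE xE eqxx/=.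
  by apply: contraNneq ex => yE; rewrite xE partner_edge_hub// -yE.
rewrite (eq_bigl (mem [set partner_edge y | y in leaves x]%SET)); last first.
  move=> e /=; apply/andP/idP => [[]//|el]; split=> //.
  case/imsetP: el => y; rewrite inE => /andP[/eqP fy yfx] ->.
  rewrite /= -fy set22/=; apply: contraNneq yfx.
  case/partner_edge_inj => [fyy|[_ <-]].
    by have := f_neq y; rewrite fyy eqxx.
  by rewrite fy.
rewrite big_imset/=.
  by apply: eq_bigr => y _; rewrite forest_weight_partner.
move=> y y'; rewrite !inE => /andP[/eqP fy _] /andP[/eqP fy' _].
move=> /partner_edge_inj[->//|[y'E _]].
by have := f_neq y'; rewrite fy' y'E fy eqxx.
Qed.

End Weights.

Hypothesis leaves_balanced : forall x, f (f x) = x ->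
  [\/ #|leaves x| = 0, #|leaves (f x)| = 0 | #|leaves x| = #|leaves (f x)|]%N.

(* [Q s t] is the share of a leaf edge at its hub.                            *)
Lemma forest_equilibrium (alpha : R) (Q : nat -> nat -> R) :
  (0 < #|V|)%N -> 0 < alpha ->
  (forall s t, (s <= #|V|)%N -> (t <= #|V| + #|V|)%N ->
    [/\ 0 < Q s t, t%:R * Q s t <= 4^-1 &
    Q s t = ((1 + Q s t) / (2 - t%:R * Q s t)) `^ alpha
        / (1 + s%:R * ((1 + Q s t) / (2 - t%:R * Q s t)) `^ alpha)]) ->
  exists v : edge E -> R,
    [/\ forall x, (#|V|%:R)^-1 <= v (partner_edge x),
      forall e, (forall x, e <> partner_edge x) -> v e = 0,
      forall e, warm_F alpha v e = 0 &
      forall x, 0 < vertex_weight alpha v x /\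
        exists s t, [/\ (s <= #|V|)%N, (t <= #|V| + #|V|)%N &
        vertex_weight alpha v x - v (partner_edge x) `^ alpha <=
        #|V|%:R * Q s t * vertex_weight alpha v x]].
Proof.
move=> N0 a0 HQ.
(* [f x] and [f (f x)] are the two hubs of the tree of [x], so [s], [t] and everything built from
   them are constant on trees. *)
pose s x := maxn #|leaves (f x)| #|leaves (f (f x))|.
pose t x := (#|leaves (f x)| + #|leaves (f (f x))|)%N.
have sf x : s (f x) = s x by rewrite /s fff maxnC.
have tf x : t (f x) = t x by rewrite /t fff addnC.
have sN x : (s x <= #|V|)%N by rewrite /s geq_max !max_card.
have tN x : (t x <= #|V| + #|V|)%N by rewrite /t leq_add// max_card.
pose q x := Q (s x) (t x).
have qf x : q (f x) = q x by rewrite /q sf tf.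
have q0 x : 0 < q x by have [] := HQ _ _ (sN x) (tN x).
have tq x : (t x)%:R * q x <= 4^-1 by have [] := HQ _ _ (sN x) (tN x).
pose z x := ((1 + q x) / (2 - (t x)%:R * q x)) `^ alpha.
have zf x : z (f x) = z x by rewrite /z qf tf.
have qE x : q x = z x / (1 + (s x)%:R * z x).
  by have [_ _ ] := HQ _ _ (sN x) (tN x).
pose w x := (if f (f x) == x then 2 - (t x)%:R * q x else 1 + q x) / #|V|%:R.
have wf x : f (f x) = x -> w (f x) = w x.
  by move=> ffx; rewrite /w fff qf tf ffx !eqxx.
have V0 : 0 < #|V|%:R :> R by rewrite ltr0n.
have z0 x : 0 < z x.
  have := tq x; have := q0 x => ? ?.
  by rewrite powR_gt0// divr_gt0//; lra.
pose D x := ((2 - (t x)%:R * q x) / #|V|%:R) `^ alpha.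
have D0 x : 0 < D x.
  by have := tq x => ?; rewrite powR_gt0// divr_gt0//; lra.
have wD x : f (f x) = x -> w x `^ alpha = D x.
  by move=> ffx; rewrite /w ffx eqxx.
have wz x : f (f x) != x -> w x `^ alpha = z x * D x.
  move=> /negPf ffx; rewrite /w ffx /z /D -powRM.
  - congr (_ `^ _); have := tq x; have := V0 => ? ?; field.
    by rewrite !gt_eqF//; lra.
  - by have := tq x; have := q0 x => ? ?; rewrite divr_ge0//; lra.
  - by have := tq x => ?; rewrite divr_ge0//; lra.
have wn x : #|V|%:R^-1 <= w x.
  rewrite /w ler_pdivlMr ?V0// mulVf ?gt_eqF ?V0//.
  by have := tq x; have := q0 x; case: ifP; lra.
have Df x : D (f x) = D x by rewrite /D qf tf.
pose v := forest_weight w.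
have vp x : v (partner_edge x) = w x by exact: forest_weight_partner.
have a1 : alpha != 0 by rewrite gt_eqF.
have Sleaf x : f (f x) != x -> vertex_weight alpha v x = w x `^ alpha.
  by move=> ffx; rewrite vertex_weight_forest// leaves_not_hub// big_set0 addr0.
have Shub x : f (f x) = x ->
    vertex_weight alpha v x = D x * (1 + #|leaves x|%:R * z x).
  move=> ffx; rewrite vertex_weight_forest// wD//.
  rewrite (eq_bigr (fun=> z x * D x)); last first.
    move=> y yx; rewrite wz ?(leaf_not_hub yx)//.
    by move: yx; rewrite inE => /andP[/eqP <- _]; rewrite zf Df.
  by rewrite sumr_const -mulr_natl; ring.
have S0 x : 0 < vertex_weight alpha v x.
  have [ffx|ffx] := eqVneq (f (f x)) x.
    by rewrite Shub// mulr_gt0// ltr_wpDr// mulr_ge0// ltW.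
  by rewrite Sleaf// wz// mulr_gt0.
(* This is where the balance of the leaves enters: one [s] serves both hubs. *)
have mE x : f (f x) = x -> #|leaves x| = 0%N \/ #|leaves x| = s x.
  by move=> ffx; rewrite /s ffx; case: (leaves_balanced ffx); lia.
(* For m = s leaves, 1 / (1 + s z) = 1 - s z / (1 + s z) = 1 - s q; for m = 0 both sides are 1. *)
have hub_share x : f (f x) = x ->
    D x / vertex_weight alpha v x = 1 - #|leaves x|%:R * q x.
  move=> ffx; rewrite Shub//; have := D0 x; have := z0 x => zx Dx.
  have [->|->] := mE x ffx; first by field; rewrite gt_eqF.
  by rewrite qE; field; rewrite !gt_eqF// ltr_wpDr// mulr_ge0// ltW.
have leaf_share x : f (f x) != x ->
    z x * D x / vertex_weight alpha v (f x) = q x.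
  move=> ffx; rewrite Shub//; have := D0 x; have := z0 x => zx Dx.
  have [m0|->] := mE (f x) (fff x).
    have : x \in leaves (f x) by rewrite inE eqxx eq_sym.
    by rewrite (cards0_eq m0) inE.
  rewrite sf zf Df [RHS]qE; field.
  by rewrite !gt_eqF// ltr_wpDr// mulr_ge0// ltW.
exists v; split => [x||e|x]; first by rewrite vp.
- exact: forest_weight0.
- have [[x ->]|ne] := pselect (exists x, e = partner_edge x); last first.
    have v0 : v e = 0 by apply: forest_weight0 => x ex; apply: ne; exists x.
    rewrite warm_FE v0 powR0// big1 ?mulr0 ?addr0 ?oppr0// => *.
    by rewrite mul0r.
  (* A central edge collects (1 - m q) + (1 - m' q) = 2 - t q from its hubs, with m and m' leaves; a
     leaf edge collects 1 at its leaf and q at its hub. *)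
  rewrite warm_FE vp /= big_setU1 ?inE 1?eq_sym ?f_neq//= big_set1.
  have [ffx|ffx] := eqVneq (f (f x)) x.
    rewrite wD// hub_share// -Df hub_share// ?fff// qf.
    rewrite /w ffx eqxx /t ffx natrD; have := V0 => ?.
    by field; rewrite gt_eqF.
  rewrite wz// leaf_share// Sleaf// wz// divff ?mulf_neq0 ?gt_eqF//.
  by rewrite /w (negPf ffx); have := V0 => ?; field; rewrite gt_eqF.
- split=> //; exists (s x), (t x); split => //; rewrite vp -/(q x).
  (* The partner edge dominates: it leaves nothing to others at a leaf and the share m q, with m <=
     n, at a hub. *)
  have [ffx|ffx] := eqVneq (f (f x)) x; last first.
    by rewrite Sleaf// subrr !mulr_ge0 ?powR_ge0// ltW.
  have := hub_share x ffx; rewrite wD//.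
  have := S0 x => Sx /(canRL (mulfVK (lt0r_neq0 Sx))) ->.
  rewrite mulrBl mul1r opprB addrC subrK ler_pM2r// ler_pM2r//.
  by rewrite ler_nat max_card.
Qed.

End DoubleStarForest.

(** The double-star encoding relative to a vertex set [U]; the intersections with [U] keep out
    values of [f] elsewhere, so that the maps of several trees can be glued. *)
Definition partner_map (V : finType) (U : {set V}) (F : {set {set V}})
    (f : V -> V) : Prop :=
  [/\ {in U, forall x, [/\ f x \in U, f x != x & f (f (f x)) = f x]},
      F = [set [set x; f x]%SET | x in U]%SET &
      {in U, forall x, f (f x) = x ->
        [\/ #|leaves f x :&: U| = 0, #|leaves f (f x) :&: U| = 0 |
            #|leaves f x :&: U| = #|leaves f (f x) :&: U|]%N}].

Lemma partner_map_stable (R : realType) (V : finType) (E H : {set {set V}})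
    (f : V -> V) : (0 < #|V|)%N -> (forall e, e \in E -> #|e| = 2%N) ->
  H \subset E -> partner_map [set: V]%SET H f ->
  exists2 C : R, 1 < C & forall alpha, C < alpha ->
    stable_equilibria E alpha H !=set0.
Proof.
move=> V0 E2 HE [fU HF bal].
have f_neq x : f x != x by case: (fU x (finset.in_setT x)).
have fff x : f (f (f x)) = f x by case: (fU x (finset.in_setT x)).
have fE x : [set x; f x]%SET \in E.
  by apply: (fintype.subsetP HE); rewrite HF; apply/imsetP; exists x.
have {}bal x : f (f x) = x -> [\/ #|leaves f x| = 0, #|leaves f (f x)| = 0 |
    #|leaves f x| = #|leaves f (f x)|]%N.
  by have := bal x (finset.in_setT x); rewrite !finset.setIT.
pose N : R := #|V|%:R; pose M : R := #|{: edge E}|%:R.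
have N0 : 0 < N by rewrite ltr0n.
have M0 : 0 <= M by rewrite ler0n.
(* With r = (3/4)^alpha, the summand 8 N yields 2 N r <= 1/4, hence t r <= 1/4 for all t <= 2 N; the
   summand 2 N M is the stability condition for eta = N r and M edges. *)
have [||C C1 HC] := @linear_powR_lt1 R (8 * N + 2 * N * M) (3 / 4).
- by rewrite ltr_pwDl ?mulr_gt0// !mulr_ge0// ltW.
- by lra.
exists C => // alpha Ca.
have a1 : 1 < alpha := lt_trans C1 Ca.
have {HC}K1 := HC _ Ca.
set r := (3 / 4) `^ alpha in K1.
have r0 : 0 < r by rewrite powR_gt0//; lra.
have MNar : 0 <= M * N * (alpha * r) by rewrite !mulr_ge0//; lra.
have rN : 8 * N * r <= 1.
  have : 8 * N * r <= 8 * N * (alpha * r).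
    by rewrite ler_pM2l ?mulr_gt0//; rewrite ler_peMl//; lra.
  by move: K1 MNar; lra.
have a0 : 0 < alpha by lra.
have N1 : 1 <= N by rewrite ler1n.
have /choice[Q HQ] : forall st : nat * nat, exists q : R,
    (st.2 <= #|V| + #|V|)%N ->
    [/\ 0 < q <= r, st.2%:R * q <= 4^-1 &
    q = ((1 + q) / (2 - st.2%:R * q)) `^ alpha
        / (1 + st.1%:R * ((1 + q) / (2 - st.2%:R * q)) `^ alpha)].
  move=> [s t] /=; have [tN|_] := boolP (t <= #|V| + #|V|)%N; last by exists 0.
  have tN' : t%:R <= 2 * N by rewrite mulr_natl mulr2n -natrD ler_nat.
  have tr : t%:R * r <= 4^-1.
    by apply: (@le_trans _ _ (2 * N * r)); [rewrite ler_pM2r|lra].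
  have r4 : r <= 4^-1 by have : r <= N * r; [rewrite ler_peMl// ltW|lra].
  have [|q Hq] := @share_equation R alpha r s t a0 _ tr (lexx _).
    by rewrite r0.
  by exists q.
have [|v [vn v0 F0 Sv]] := @forest_equilibrium R V E f f_neq fff fE bal alpha
    (fun s t => Q (s, t)) V0 a0.
  move=> s t _ /(HQ (s, t))[/andP[? _] ? ?]; by split.
have vge0 e : 0 <= v e.
  have [[x ->]|ne] := pselect (exists x, e = partner_edge fE x).
    by apply: le_trans (vn x); rewrite invr_ge0 ltW.
  by rewrite v0// => x ex; apply: ne; exists x.
have S0 x : 0 < vertex_weight alpha v x by have [] := Sv x.
exists v; split.
- split=> //; apply: (warm_sum_eq1 V0 _ F0) => x; by rewrite gt_eqF.
- move=> e; rewrite HF; split.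
    move=> /imsetP[x _ ex]; have -> : e = partner_edge fE x by exact: val_inj.
    by apply: lt_le_trans (vn x); rewrite invr_gt0.
  move=> eH; apply: v0 => x ex; move: eH; rewrite ex => /negP; apply.
  by apply/imsetP; exists x.
- apply: (@dominated_linearly_stable _ _ _ _ _ (N * r)) => //.
  + move=> e ve.
    have [[x ->]//|ne] := pselect (exists x, e = partner_edge fE x).
    by move: ve; rewrite v0 ?ltxx// => x ex; apply: ne; exists x.
  + by rewrite mulr_ge0// ltW.
  + move=> x; exists (partner_edge fE x); first by rewrite /= set21.
    have [_ [s [t [_ tN]]]] := Sv x.
    move/le_trans; apply; rewrite ler_pM2r// ler_pM2l//.
    by have [/andP[_]] := HQ (s, t) tN.
  + by move=> e; apply: E2; exact: valP.
  + by rewrite -/M; move: K1 rN; have := mulr_gt0 (mulr_gt0 N0 a0) r0; lra.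
Qed.

(** * Encoding stars, whisker graphs and forests by partner maps *)

Lemma star_partner_map (V : finType) (U : {set V}) (F : {set {set V}}) :
  star_graph U F -> exists f, partner_map U F f.
Proof.
move=> [c [L [/card_gt0P[x0 x0L] cL -> ->]]].
have xc x : x \in L -> x != c by move=> xL; apply: contraNneq cL => <-.
(* An arbitrary leaf [x0] is promoted to second hub; it has no leaves of its own. *)
pose f x := if x == c then x0 else c.
have fc : f c = x0 by rewrite /f eqxx.
have fL x : x \in L -> f x = c by move=> xL; rewrite /f (negPf (xc x xL)).
have l0 : leaves f x0 = finset.set0.
  apply/setP => y; rewrite !inE (fL x0)// /f.
  case: (eqVneq y c) => [_|_] /=; first by rewrite andbF.
  by rewrite [c == x0]eq_sym (negPf (xc _ x0L)).
exists f; split.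
- move=> x; rewrite !inE => /predU1P[->|xL].
    by rewrite fc (fL x0)// fc x0L orbT xc.
  by rewrite (fL x)// fc (fL x0)// eqxx eq_sym xc.
- apply/setP => e; apply/imsetP/imsetP => [[x xL ->]|[x]].
    by exists x; rewrite ?inE ?xL ?orbT// fL// finset.setUC.
  rewrite !inE => /predU1P[->|xL] ->; first by exists x0; rewrite ?fc.
  by exists x => //; rewrite fL// finset.setUC.
- move=> x; rewrite !inE => /predU1P[->|xL].
    by move=> _; constructor 2; rewrite fc l0 finset.set0I cards0.
  by rewrite (fL x xL) fc => <-; constructor 1; rewrite l0 finset.set0I cards0.
Qed.

Lemma whisker_partner_map (V : finType) r (U : {set V}) (F : {set {set V}}) :
  sym_whisker_graph r U F -> exists f, partner_map U F f.
Proof.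
move=> [a [b [A [B [ab [dAB dab] [cA cB] -> ->]]]]].
have ABF x : x \in [set a; b]%SET -> (x \in A) || (x \in B) = false.
  by move=> /(disjointFr dab); rewrite inE.
have /norP[aA aB] := negbT (ABF a (set21 a b)).
have /norP[bA bB] := negbT (ABF b (set22 a b)).
have AB x : x \in A -> x \notin B by move=> xA; rewrite (disjointFr dAB xA).
pose f x := if (x == b) || (x \in A) then a else b.
have fa : f a = b by rewrite /f (negPf ab) (negPf aA).
have fb : f b = a by rewrite /f eqxx.
have fA x : x \in A -> f x = a by rewrite /f => ->; rewrite orbT.
have fB x : x \in B -> f x = b.
  by rewrite /f => xB; rewrite (disjointFl dAB xB) orbF; case: eqVneq => // xb;
    rewrite -xb xB in bB.
have fab x : f x = a \/ f x = b by rewrite /f; case: ifP; [left|right].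
have fff x : f (f (f x)) = f x by case: (fab x) => ->; rewrite ?fa ?fb ?fa.
set W := ([set a; b] :|: (A :|: B))%SET.
have aW : a \in W by rewrite !inE eqxx.
have bW : b \in W by rewrite !inE eqxx orbT.
have la : (leaves f a :&: W = A)%SET.
  apply/setP => x; rewrite !inE fa; apply/idP/idP.
    case/andP => /andP[/eqP fx xb] /orP[/orP[/eqP xa|/eqP xb']|/orP[//|xB]].
    - by move: ab; rewrite -fx xa fa eqxx.
    - by rewrite xb' eqxx in xb.
    - by move: ab; rewrite -fx fB// eqxx.
  move=> xA; rewrite fA// eqxx xA !orbT andbT/=.
  by apply: contraNneq bA => <-.
have lb : (leaves f b :&: W = B)%SET.
  apply/setP => x; rewrite !inE fb; apply/idP/idP.
    case/andP => /andP[/eqP fx xa] /orP[/orP[/eqP xa'|/eqP xb]|/orP[xA|//]].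
    - by rewrite xa' eqxx in xa.
    - by move: ab; rewrite -fx xb fb eqxx.
    - by move: ab; rewrite -fx fA// eqxx.
  move=> xB; rewrite fB// eqxx xB !orbT andbT/=.
  by apply: contraNneq aB => <-.
exists f; split.
- move=> x xW; split => //; first by case: (fab x) => ->.
  move: xW; rewrite !inE => /orP[/orP[/eqP->|/eqP->]|/orP[xA|xB]].
  + by rewrite fa eq_sym.
  + by rewrite fb.
  + by rewrite fA//; apply: contraNneq aA => ->.
  + by rewrite fB//; apply: contraNneq bB => ->.
- apply/setP => e; rewrite !inE; apply/idP/imsetP.
    case/orP => [/eqP->|/orP[/imsetP[x xA ->]|/imsetP[x xB ->]]].
    + by exists a => //; rewrite fa.
    + by exists x; rewrite ?inE ?xA ?orbT// fA// finset.setUC.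
    + by exists x; rewrite ?inE ?xB ?orbT// fB// finset.setUC.
  move=> [x]; rewrite !inE => /orP[/orP[/eqP->|/eqP->]|/orP[xA|xB]] ->.
  + by rewrite fa eqxx.
  + by rewrite fb finset.setUC eqxx.
  + rewrite fA//; apply/orP; right; apply/orP; left.
    by apply/imsetP; exists x; rewrite // finset.setUC.
  + rewrite fB//; apply/orP; right; apply/orP; right.
    by apply/imsetP; exists x; rewrite // finset.setUC.
- move=> x _ ffx; have [xa|xb] : x = a \/ x = b by rewrite -ffx; exact: fab.
  + by constructor 3; rewrite xa fa la lb cA cB.
  + by constructor 3; rewrite xb fb la lb cA cB.
Qed.

(** Each vertex follows the map of its own tree [J x]. As that map preserves the tree, the leaves at
    a vertex are computed inside the tree, and the balance condition carries over. *)
Lemma forest_partner_map (V : finType) (E : {set {set V}}) (k : nat)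
    (VV : 'I_k -> {set V}) (EE : 'I_k -> {set {set V}}) :
  sym_whisker_forest E VV EE ->
  exists f, partner_map [set: V]%SET (\bigcup_j EE j)%SET f.
Proof.
move=> [conn _ cover disj shape].
have /choice[g gP] : forall j, exists g, partner_map (VV j) (EE j) g.
  move=> j; case: (shape j) => [|[r _]]; first exact: star_partner_map.
  exact: whisker_partner_map.
have /choice[J xJ] : forall x, exists j, x \in VV j.
  move=> x; have : x \in [set: V]%SET by [].
  by rewrite -cover => /bigcupP[j _ ?]; exists j.
have JE j x : x \in VV j -> J x = j.
  move=> xj; apply/eqP/contraT => /disj/disjointFl/(_ xj).
  by rewrite xJ.
have gf j x : x \in VV j -> J (g j x) = j.
  by move=> xj; apply: JE; have [/(_ x xj)[]] := gP j.
have [f fj] : exists f, forall x, f x = g (J x) x.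
  by exists (fun x => g (J x) x).
have Jf x : J (f x) = J x by rewrite fj gf.
have lE x : (leaves f x :&: [set: V] = leaves (g (J x)) x :&: VV (J x))%SET.
  rewrite finset.setIT; apply/setP => y; rewrite !inE; apply/idP/idP.
    move=> /andP[/eqP fy yfx]; have Jy : J y = J x by rewrite -fy Jf.
    have gy : g (J x) y = x by rewrite -Jy -fj.
    by rewrite gy eqxx -[in VV _]Jy xJ andbT -fj.
  move=> /andP[/andP[/eqP gy ygx] /JE Jy].
  by rewrite [f y]fj Jy gy eqxx fj.
exists f; split.
- move=> x _; have [/(_ x (xJ x))[gU gn ggg] _ _] := gP (J x).
  by split; [rewrite inE|rewrite fj|rewrite (fj (f _)) !Jf (fj (f _)) Jf fj].
- apply/setP => e; apply/bigcupP/imsetP.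
    move=> [j _]; have [_ -> _] := gP j => /imsetP[x xj ->].
    by exists x => //; rewrite fj (JE j).
  move=> [x _ ->]; exists (J x) => //; have [_ -> _] := gP (J x).
  by apply/imsetP; exists x; rewrite ?fj.
- move=> x _ ffx; rewrite (lE x).
  have := lE (f x); rewrite Jf => ->; rewrite fj.
  have [_ _ /(_ x (xJ x))] := gP (J x); apply.
  by rewrite -[RHS]ffx [RHS]fj Jf fj.
Qed.

Unset Implicit Arguments.

Theorem theorem1p26 (R : realType) :
  (forall (r : nat) (V : finType) (E : {set {set V}}),
     (1 <= r)%N -> sym_whisker_graph r [set: V]%SET E ->
     exists2 alphaG : R, 1 < alphaG &
       forall alpha : R, alphaG < alpha ->
         stable_equilibria E alpha E !=set0)
  /\
  (forall (V : finType) (E : {set {set V}}),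
     connected_graph [set: V]%SET E ->
     forall (k : nat) (VV : 'I_k -> {set V}) (EE : 'I_k -> {set {set V}}),
       sym_whisker_forest E VV EE ->
       exists C : R, forall alpha : R, C < alpha ->
         admits_stable_allocation E alpha EE).
Proof.
split=> [r V E _ G|V E [graphE V0 _] k VV EE forest].
  have [f fP] := whisker_partner_map G.
  apply: (partner_map_stable R _ _ _ fP) => //.
    by case: G => a _; apply/card_gt0P; exists a.
  have [fU -> _] := fP; move=> e /imsetP[x _ ->].
  by rewrite cards2 eq_sym; have [_ -> _] := fU x (finset.in_setT x).
have [f fP] := forest_partner_map forest.
have E2 e : e \in E -> #|e| = 2%N by case/graphE.
have HE : (\bigcup_j EE j)%SET \subset E.
  by apply/finset.bigcupsP => j _; case: forest => /(_ j)[].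
rewrite cardsT in V0.
have [C _ HC] := partner_map_stable R V0 E2 HE fP.
exists C => alpha /HC[v [veq vsup vst]].
by exists v; split => //; left.
Qed.
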